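(* Let $q\in(0,1)$ and, for each $n\ge1$, let $w\in S_n$ be Mallows distributed with parameter $q$. Then $$\lim_{n\to\infty}\frac1n\,\mathbb{E}(C_1(w))=\frac{1-q}{q}\,(q;q)_\infty\sum_{j=0}^\infty\frac{q^{(j+1)^2}}{(q;q)_j^2},$$ where $C_1(w)$ is the number of fixed points of $w$.
   Context: For $w\in S_n$, $l(w)$ is the number of inversions of $w$ (pairs $i<j$ with $w(i)>w(j)$). A random $w\in S_n$ is Mallows distributed with parameter $q$ if $\mathbb{P}(w=w_0)=q^{l(w_0)}/Z_n(q)$ for $w_0\in S_n$, where $Z_n(q)=\prod_{k=1}^{n}(1+q+\dots+q^{k-1})$. The $q$-Pochhammer symbol is $(a;q)_r=\prod_{i=0}^{r-1}(1-aq^i)$ for $r\in\{0,1,2,\dots\}\cup\{\infty\}$. *)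

(* Defs.v *)
From mathcomp Require Import all_boot all_order all_algebra perm.
From mathcomp Require Import all_classical all_reals all_analysis.

Set Implicit Arguments.
Unset Strict Implicit.
Unset Printing Implicit Defensive.

Import Order.TTheory GRing.Theory Num.Theory.
Import numFieldNormedType.Exports.

Local Open Scope classical_set_scope.
Local Open Scope ring_scope.

Definition inversions (n : nat) (w : 'S_n) : nat :=
  #|[set p : 'I_n * 'I_n | (p.1 < p.2)%N && (w p.2 < w p.1)%N]%SET|.

Definition fixed_points (n : nat) (w : 'S_n) : nat :=
  #|[set i : 'I_n | w i == i]%SET|.

Definition mallows_Z (R : realType) (n : nat) (q : R) : R :=
  \prod_(1 <= k < n.+1) \sum_(0 <= i < k) q ^+ i.

(* 'S_n carries the discrete sigma-algebra; since 'S_n is finite, measurability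
   of w only has to be required on the fibres of points. *)
Definition mallows_distributed (d : measure_display) (T : measurableType d)
    (R : realType) (P : probability T R) (n : nat) (q : R) (w : T -> 'S_n) :
    Prop :=
  forall w0 : 'S_n,
    measurable (w @^-1` [set w0]) /\
    P (w @^-1` [set w0]) = (q ^+ inversions w0 / mallows_Z n q)%:E.

Definition qpoch (R : realType) (a q : R) (r : nat) : R :=
  \prod_(0 <= i < r) (1 - a * q ^+ i).

Definition qpoch_inf (R : realType) (a q : R) : R := limn (qpoch a q).

(* Main.v *)
(* If w i = i and w sends a positions below i to values above i, then it also
   sends a positions above i to values below i, and removing the point (i, i)
   loses 2a inversions.  Together with the a^2 inversions between the crossing
   points this gives, with s points below i and t above, the probability
     P(w i = i) = [s]! [t]! / [s+t+1]! *
                    sum_a q^((a+1)^2 - 1) binom(s, a)_q binom(t, a)_q.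
   The same formula for P(w i = j) satisfies, term by term, the recursion obtained
   by deleting the first letter of w, which is how it is proved here.  The
   difference between P(w i = i) and its limit as s, t -> oo is O(q^s + q^t), so
   the sum over i differs from n times that limit by O(1). *)
Require Import Defs.
From mathcomp Require Import all_boot all_order all_algebra perm.
From mathcomp Require Import ring lra zify.
From mathcomp Require Import all_classical all_reals all_analysis measurable_realfun.

Set Implicit Arguments.
Unset Strict Implicit.
Unset Printing Implicit Defensive.

Import Order.TTheory GRing.Theory Num.Theory.
Import numFieldNormedType.Exports.

Local Open Scope classical_set_scope.
Local Open Scope ring_scope.

(** * Inversions and deletion of the first letter *)

Lemma inversionsE (n : nat) (w : 'S_n) :
  inversions w = (\sum_(i < n) \sum_(j < n) ((i < j) && (w j < w i)))%N.
Proof.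
rewrite /inversions -sum1_card pair_big /= big_mkcond /=.
by apply: eq_bigr => p _; rewrite inE; case: ifP.
Qed.

(** The first letter [k] is inverted with exactly the [k] smaller values, and lifting keeps the
    relative order of the other letters. *)
Lemma inversions_lift_perm (n : nat) (k : 'I_n.+1) (s : 'S_n) :
  inversions (lift_perm ord0 k s) = (k + inversions s)%N.
Proof.
rewrite !inversionsE big_ord_recl; congr addn.
  rewrite big_ord_recl ltnn andFb add0n.
  under eq_bigr do rewrite lift_perm_id lift_perm_lift /=.
  (* Summing over values instead of positions removes [s] from the count. *)
  rewrite (reindex_inj (h := (s^-1)%g)); last exact: perm_inj.
  under eq_bigr do rewrite permKV.
  under eq_bigr => j _.
    rewrite (_ : (bump k j < k)%N = (j < k)%N); last first.
      by rewrite /bump; case: leqP; lia.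
    over.
  rewrite -(big_mkord xpredT (fun j => nat_of_bool (j < k)%N)).
  rewrite (big_cat_nat (n := k)) //=; last by rewrite -ltnS.
  rewrite [X in (_ + X)%N]big_nat_cond [X in (_ + X)%N]big1 ?addn0; last first.
    by move=> j /andP[/andP[kj _] _]; rewrite ltnNge kj.
  rewrite (eq_big_nat _ _ (F2 := fun=> 1%N)); last by move=> j /andP[_ ->].
  by rewrite sum_nat_const_nat subn0 muln1.
apply: eq_bigr => i _; rewrite big_ord_recl ltn0 andFb add0n.
apply: eq_bigr => j _; rewrite !lift_perm_lift; congr (nat_of_bool (_ && _)).
by rewrite /= /bump; do 2 case: leqP; lia.
Qed.

Lemma big_lift_perm (R : Type) (idx : R) (op : Monoid.com_law idx) (n : nat)
    (F : 'S_n.+1 -> R) :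
  \big[op/idx]_(w : 'S_n.+1) F w =
  \big[op/idx]_(k < n.+1) \big[op/idx]_(s : 'S_n) F (lift_perm ord0 k s).
Proof.
rewrite pair_big /=.
rewrite (reindex (fun p : 'I_n.+1 * 'S_n => lift_perm ord0 p.1 p.2)) //=.
apply: onW_bij; apply: inj_card_bij => [[k s] [k' s'] /= e|].
  have ek : k = k' by rewrite -(lift_perm_id ord0 k s) e lift_perm_id.
  congr pair => //; apply/permP => i; apply: (@lift_inj _ k).
  by rewrite -(lift_perm_lift ord0) e lift_perm_lift ek.
by rewrite card_prod card_ord !card_Sn factS.
Qed.

(** * q-counting of permutations with one prescribed value *)

Section qcount.
Variables (R : realType) (q : R).
Hypotheses (q0 : 0 < q) (q1 : q < 1).
Local Notation P := (qpoch q q).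

(** The Gaussian binomial: [P n] is (1 - q)^n [n]!, and the powers of 1 - q cancel. *)
Definition qbin (n k : nat) : R :=
  if (k <= n)%N then P n / (P k * P (n - k)) else 0.

Lemma qpoch0 : P 0 = 1.
Proof. by rewrite /qpoch big_nil. Qed.

Lemma qpochS n : P n.+1 = P n * (1 - q ^+ n.+1).
Proof. by rewrite /qpoch big_nat_recr //= -exprS. Qed.

Lemma qpoch_gt0 n : 0 < P n.
Proof.
elim: n => [|n IH]; first by rewrite qpoch0.
by rewrite qpochS mulr_gt0 // subr_gt0 exprn_ilt1 // ltW.
Qed.

(** The q-analogue of (n+1) binom(n, k) = (k+1) binom(n+1, k+1). *)
Lemma qbin_absorb n k :
  (1 - q ^+ n.+1) * qbin n k = (1 - q ^+ k.+1) * qbin n.+1 k.+1.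
Proof.
rewrite /qbin ltnS; case: leqP => _; rewrite ?mulr0 // subSS !qpochS.
have := qpoch_gt0 k; have := qpoch_gt0 (n - k).
have : 0 < 1 - q ^+ k.+1 by rewrite subr_gt0 exprn_ilt1 // ltW.
by move=> /lt0r_neq0 a /lt0r_neq0 b /lt0r_neq0 c; field; rewrite ?a ?b ?c.
Qed.

Lemma mulBr_geometric a b : (a <= b)%N ->
  (1 - q) * (\sum_(a <= k < b) q ^+ k) = q ^+ a - q ^+ b.
Proof.
move=> ab; rewrite mulr_sumr.
rewrite (@telescope_sumr_eq _ _ _ (fun k => - q ^+ k)) //; first by ring.
by move=> k _; rewrite exprS; ring.
Qed.

(** A first letter [k] contributes q^k, and these powers add up to a geometric sum, which yields the
    last factor of [P]. *)
Lemma sum_inversions n :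
  (1 - q) ^+ n * \sum_(w : 'S_n) q ^+ inversions w = P n.
Proof.
elim: n => [|n IH].
  rewrite expr0 mul1r qpoch0 (eq_bigr (fun=> 1)); last first.
    by move=> w _; rewrite inversionsE big_ord0.
  by rewrite sumr_const card_Sn.
rewrite big_lift_perm /=.
under eq_bigr => k _.
  under eq_bigr do rewrite inversions_lift_perm exprD.
  rewrite -mulr_sumr; over.
rewrite -mulr_suml -(big_mkord xpredT (fun k => q ^+ k)) exprS mulrACA.
by rewrite mulBr_geometric // IH qpochS expr0 mulrC.
Qed.

Lemma mallows_ZE n : (1 - q) ^+ n * mallows_Z n q = P n.
Proof.
elim: n => [|n IH]; first by rewrite expr0 mul1r /mallows_Z big_geq ?qpoch0.
rewrite /mallows_Z big_nat_recr //= -/(mallows_Z n q) exprSr mulrACA IH.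
by rewrite mulBr_geometric // qpochS expr0.
Qed.

(* [(1 - q)^m] times the weight of the [w] in [S_(m+1)] with [w i = j]; [c] counts
   the positions below [i] sent to values below [j]. *)
Definition crossing_sum (m i j : nat) : R :=
  P i * P (m - i) * \sum_(0 <= c < i.+1)
    q ^+ ((i.+1 - c) * (j.+1 - c)).-1 * qbin j c * qbin (m - j) (i - c).

Lemma crossing_sum0 m j : (j <= m)%N -> crossing_sum m 0 j = P m * q ^+ j.
Proof.
move=> jm; rewrite /crossing_sum big_nat1 qpoch0 /qbin !subn0 /= qpoch0.
rewrite !mul1r !divff ?lt0r_neq0 ?qpoch_gt0 // !mulr1.
by congr (_ * q ^+ _); lia.
Qed.

(** The two terms stand for a first letter below [j] and above [j]. After absorption their [c]-th
    summands carry the factors 1 - q^c and q^c (1 - q^(i+1-c)), which add up to 1 - q^(i+1), the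
    factor that turns [P i] into [P i.+1]. *)
Lemma crossing_sumS m i j : (i <= m)%N -> (j <= m.+1)%N ->
  crossing_sum m.+1 i.+1 j =
  (1 - q ^+ j) * crossing_sum m i j.-1 +
  (q ^+ j.+1 - q ^+ m.+2) * crossing_sum m i j.
Proof.
move=> im jm.
have -> : (1 - q ^+ j) * crossing_sum m i j.-1 = P i * P (m - i) *
  \sum_(0 <= c < i.+2) q ^+ ((i.+2 - c) * (j.+1 - c)).-1 *
     ((1 - q ^+ c) * qbin j c) * qbin (m.+1 - j) (i.+1 - c).
  rewrite /crossing_sum mulrCA; congr *%R.
  (* The new summand [c = 0] vanishes with 1 - q^0, so the index can be shifted by one. *)
  rewrite [RHS]big_nat_recl // expr0 subrr mul0r mulr0 mul0r add0r.
  case: j jm => [|j] jm.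
    rewrite expr0 subrr mul0r big1 // => c _.
    by rewrite /qbin ltn0 !mulr0 mul0r.
  rewrite mulr_sumr /=; apply: eq_bigr => c _.
  by rewrite !subSS -qbin_absorb; ring.
have -> : (q ^+ j.+1 - q ^+ m.+2) * crossing_sum m i j = P i * P (m - i) *
  \sum_(0 <= c < i.+2) q ^+ ((i.+2 - c) * (j.+1 - c)).-1 *
     qbin j c * (q ^+ c * (1 - q ^+ (i.+1 - c)) * qbin (m.+1 - j) (i.+1 - c)).
  rewrite /crossing_sum mulrCA; congr *%R.
  rewrite [RHS]big_nat_recr //= subnn expr0 subrr mulr0 mul0r mulr0 addr0.
  rewrite mulr_sumr; apply: eq_big_nat => c /andP[_ ci].
  rewrite subSn //.
  have [jc|cj] := ltnP j c; first by rewrite /qbin leqNgt jc /= !(mulr0,mul0r).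
  (* At [j = m.+1], where [m - j] is truncated, both sides are 0. *)
  move: jm; rewrite leq_eqVlt => /orP[/eqP -> | jm].
    rewrite subrr mul0r subnn /qbin; case: ifP => _; rewrite ?mulr0 //.
  rewrite ltnS in jm; rewrite !subSn //; last exact: ltnW.
  have -> : q ^+ j.+1 - q ^+ m.+2 = q ^+ j.+1 * (1 - q ^+ (m - j).+1).
    by rewrite mulrBr mulr1 -exprD; congr (_ - q ^+ _); lia.
  have expE : q ^+ j.+1 * q ^+ ((i - c).+1 * (j - c).+1).-1 =
      q ^+ ((i - c).+2 * (j - c).+1).-1 * q ^+ c.
    by rewrite -!exprD; congr (q ^+ _); nia.
  transitivity (q ^+ j.+1 * q ^+ ((i - c).+1 * (j - c).+1).-1 * qbin j c *
      ((1 - q ^+ (m - j).+1) * qbin (m - j) (i - c))); first by ring.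
  by rewrite expE qbin_absorb; ring.
rewrite /crossing_sum -mulrDr subSS qpochS -!mulrA; congr *%R.
rewrite mulrCA; congr *%R; rewrite -big_split /= mulr_sumr.
apply: eq_big_nat => c /andP[_ ci].
have -> : 1 - q ^+ i.+1 = (1 - q ^+ c) + q ^+ c * (1 - q ^+ (i.+1 - c)).
  by rewrite mulrBr mulr1 -exprD subnKC //; ring.
by ring.
Qed.

(** Induction on [m], deleting the first letter [k]: if [i] is not the first position, the target
    [j] becomes [j.-1] for [k < j], stays [j] for [k > j], and [k = j] is impossible. *)
Lemma sum_inversions_fix m (i j : 'I_m.+1) :
  (1 - q) ^+ m * \sum_(w : 'S_m.+1 | w i == j) q ^+ inversions w =
  crossing_sum m i j.
Proof.
elim: m i j => [|m IH] i j; rewrite big_mkcond big_lift_perm /=.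
  rewrite expr0 mul1r big_ord1 (ord1 i) (ord1 j) crossing_sum0 //.
  rewrite (eq_bigr (fun=> 1)) => [|w _]; last first.
    by rewrite inversions_lift_perm inversionsE big_ord0 lift_perm_id eqxx.
  by rewrite sumr_const card_Sn qpoch0 mul1r.
have [i'|] := unliftP ord0 i; last first.
  move=> ->; rewrite (crossing_sum0 (leq_ord j)) (bigD1 j) //=.
  rewrite [X in _ * (_ + X)]big1 ?addr0; last first.
    move=> k kj; rewrite big1 // => s _.
    by rewrite lift_perm_id (negbTE kj).
  rewrite (eq_bigr (fun s => q ^+ j * q ^+ inversions s)) => [|s _]; last first.
    by rewrite lift_perm_id eqxx inversions_lift_perm exprD.
  by rewrite -mulr_sumr mulrCA sum_inversions mulrC.
move=> ->{i}; rewrite lift0 (crossing_sumS (leq_ord i') (leq_ord j)).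
have swapE k : (1 - q) ^+ m * \sum_(s : 'S_m.+1)
    (if lift_perm ord0 k s (lift ord0 i') == j
     then q ^+ inversions (lift_perm ord0 k s) else 0) =
  if (k < j)%N then q ^+ k * crossing_sum m i' j.-1
  else if k == j then 0 else q ^+ k * crossing_sum m i' j.
  have -> : \sum_(s : 'S_m.+1)
    (if lift_perm ord0 k s (lift ord0 i') == j
     then q ^+ inversions (lift_perm ord0 k s) else 0) =
    q ^+ k * \sum_(s : 'S_m.+1 | lift k (s i') == j) q ^+ inversions s.
    rewrite -big_mkcond mulr_sumr; apply: eq_big => s.
      by rewrite lift_perm_lift.
    by rewrite inversions_lift_perm exprD.
  have [j' ejk|->] := unliftP k j; last first.
    rewrite ltnn eqxx big1 ?mulr0 // => s; by rewrite eq_sym (negbTE (neq_lift _ _)).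
  rewrite (eq_bigl (fun s : 'S_m.+1 => s i' == j')); last first.
    by move=> s; rewrite ejk (inj_eq (@lift_inj _ k)).
  rewrite mulrCA IH ejk [k == _](negbTE (neq_lift _ _)) /=.
  have -> : (k < bump k j')%N = (k <= j')%N by rewrite /bump; case: leqP; lia.
  by rewrite /bump; case: leqP.
rewrite exprS -mulrA mulr_sumr (eq_bigr _ (fun k _ => swapE k)).
rewrite -(big_mkord xpredT (fun k => if (k < j)%N then q ^+ k * crossing_sum m i' j.-1
  else if k == j :> nat then 0 else q ^+ k * crossing_sum m i' j)).
(* The geometric sums over [k < j] and [k > j] produce the two coefficients of [crossing_sumS]. *)
rewrite (@big_cat_nat _ _ _ j) //=; last exact: ltnW.
rewrite mulrDr; congr (_ + _).
  rewrite (eq_big_nat _ _ (F2 := fun k => q ^+ k * crossing_sum m i' j.-1)).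
    by rewrite -mulr_suml mulrA mulBr_geometric // expr0.
  by move=> k /andP[_ ->].
rewrite big_ltn // ltnn eqxx add0r.
rewrite (eq_big_nat _ _ (F2 := fun k => q ^+ k * crossing_sum m i' j)).
  by rewrite -mulr_suml mulrA mulBr_geometric.
by move=> k /andP[jk _]; rewrite ltnNge ltnW //= gtn_eqF.
Qed.

Lemma mallows_Z_gt0 n : 0 < mallows_Z n q.
Proof.
have := qpoch_gt0 n; rewrite -mallows_ZE.
by rewrite pmulr_rgt0 // exprn_gt0 // subr_gt0.
Qed.

(** Linearity of expectation over positions. The factor [1 - q] is left over because [P m.+1]
    absorbs m+1 powers of 1 - q and [crossing_sum m] only m. *)
Lemma sum_fixed_points m :
  (\sum_(w : 'S_m.+1) (fixed_points w)%:R * q ^+ inversions w) / mallows_Z m.+1 q =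
  \sum_(0 <= s < m.+1) (1 - q) * crossing_sum m s s / P m.+1.
Proof.
rewrite big_mkord.
have -> : \sum_(w : 'S_m.+1) (fixed_points w)%:R * q ^+ inversions w =
    \sum_(i < m.+1) \sum_(w : 'S_m.+1 | w i == i) q ^+ inversions w.
  under [RHS]eq_bigr do rewrite big_mkcond.
  rewrite exchange_big /=; apply: eq_bigr => w _.
  rewrite /fixed_points -sum1_card natr_sum mulr_suml -big_mkcond /=.
  by apply: eq_big => [i|i _]; rewrite ?inE // mul1r.
rewrite mulr_suml; apply: eq_bigr => i _.
rewrite -sum_inversions_fix -(mallows_ZE m.+1) exprSr.
have /lt0r_neq0 a := mallows_Z_gt0 m.+1.
have /lt0r_neq0 b : 0 < 1 - q by rewrite subr_gt0.
have /lt0r_neq0 c : 0 < (1 - q) ^+ m by rewrite exprn_gt0 // subr_gt0.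
by field; rewrite ?a ?b ?c.
Qed.

(** * Geometric error bounds for q-Pochhammer symbols and weights *)

Local Notation p := (qpoch_inf q q).

Lemma qpoch_le1 n : P n <= 1.
Proof.
elim: n => [|n IH]; first by rewrite qpoch0.
rewrite qpochS mulr_ile1 ?gerBl ?exprn_ge0 ?(ltW q0) ?(ltW (qpoch_gt0 n)) //.
by rewrite subr_ge0 exprn_ile1 ?ltW.
Qed.

(** The Weierstrass inequality: a product of factors 1 - x_i with x_i in [0, 1] is at least 1 minus
    the sum of the x_i, here a geometric sum. *)
Lemma qpoch_addl_ge n m :
  P n * (1 - (q ^+ n.+1 - q ^+ (n + m).+1) / (1 - q)) <= P (n + m).
Proof.
elim: m => [|m IH]; first by rewrite addn0 subrr mul0r subr0 mulr1.
rewrite addnS qpochS; set x := q ^+ (n + m).+1.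
have b0 : 0 < 1 - q by rewrite subr_gt0.
have x01 : 0 <= x <= 1 by rewrite exprn_ge0 ?exprn_ile1 // ltW.
have xS : q ^+ (n + m).+2 = q * x by rewrite exprS.
have y0 : 0 <= (q ^+ n.+1 - x) / (1 - q).
  rewrite divr_ge0 ?(ltW b0) // subr_ge0 ler_wiXn2l ?ltW //; lia.
have -> : (q ^+ n.+1 - q * x) / (1 - q) = (q ^+ n.+1 - x) / (1 - q) + x.
  by field; rewrite lt0r_neq0.
have Pn := qpoch_gt0 n.
apply: (@le_trans _ _ (P n * (1 - (q ^+ n.+1 - x) / (1 - q)) * (1 - x))).
  by rewrite -mulrA ler_pM2l //; nra.
by rewrite ler_wpM2r // subr_ge0; case/andP: x01.
Qed.

Lemma qpoch_sub_le n m : (n <= m)%N -> P n - P m <= q ^+ n / (1 - q).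
Proof.
move=> /subnKC <-; set k := (m - n)%N.
have := qpoch_addl_ge n k; rewrite mulrBl.
have K0 : 0 < (1 - q)^-1 by rewrite invr_gt0 subr_gt0.
have a0 : 0 <= q ^+ (n + k).+1 by rewrite exprn_ge0 ?ltW.
have b0 : 0 < q ^+ n by rewrite exprn_gt0.
have Pn := qpoch_gt0 n; have Pn1 := qpoch_le1 n.
have c0 := mulr_ge0 a0 (ltW K0); have d0 := mulr_gt0 b0 K0.
have e0 : q * (q ^+ n / (1 - q)) <= q ^+ n / (1 - q) by rewrite ler_piMl // ltW.
have f0 := mulr_ge0 (ltW Pn) c0.
have g0 : P n * (q ^+ n / (1 - q)) <= q ^+ n / (1 - q) by rewrite ler_piMl // ltW.
rewrite exprS -mulrA; nra.
Qed.

Lemma qpoch_nonincreasing n m : (n <= m)%N -> P m <= P n.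
Proof.
move=> /subnKC <-; elim: (m - n)%N => [|k IH]; first by rewrite addn0.
apply: le_trans IH; rewrite addnS qpochS ler_piMr ?ltW ?qpoch_gt0 //.
by rewrite gtrBl exprn_gt0.
Qed.

(** Once the geometric tail after [N] is at most 1/2, the later factors multiply to at least 1/2.
    This makes [p] positive. *)
Lemma qpoch_lower_bound : exists2 c : R, 0 < c & forall n, c <= P n.
Proof.
have b0 : 0 < 1 - q by rewrite subr_gt0.
have [N hN] : exists N, q ^+ N.+1 / (1 - q) <= 2^-1.
  have qc : geometric 1 q @ \oo --> 0 by apply: cvg_geometric; rewrite gtr0_norm.
  have e0 : 0 < (1 - q) / 2 by rewrite divr_gt0.
  have [N _ /(_ N.+1 (leqnSn _))] := cvgr0_norm_le _ qc _ e0.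
  rewrite /= mul1r gtr0_norm ?exprn_gt0 // => h.
  by exists N; rewrite ler_pdivrMr // mulrC.
exists (P N / 2); first by rewrite divr_gt0 ?qpoch_gt0.
move=> n; apply: (@le_trans _ _ (P (N + n))); last first.
  by apply: qpoch_nonincreasing; rewrite leq_addl.
apply: le_trans (qpoch_addl_ge N n); rewrite ler_pM2l ?qpoch_gt0 //.
have : 0 <= q ^+ (N + n).+1 / (1 - q) by rewrite divr_ge0 ?exprn_ge0 ?ltW.
by rewrite mulrBl; lra.
Qed.

Lemma qpoch_cvg : P n @[n --> \oo] --> p.
Proof.
apply/cvg_ex; exists (inf (range (qpoch q q))).
apply: nonincreasing_cvgn; first by move=> n m; exact: qpoch_nonincreasing.
by exists 0 => _ [n _ <-]; rewrite ltW ?qpoch_gt0.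
Qed.

Lemma qpoch_inf_le n : p <= P n.
Proof.
apply: limr_le; first exact: qpoch_cvg.
by exists n => // m /= nm; exact: qpoch_nonincreasing.
Qed.

Lemma qpoch_inf_le1 : p <= 1.
Proof. exact: le_trans (qpoch_inf_le 0) (qpoch_le1 0). Qed.

Lemma qpoch_inf_gt0 : 0 < p.
Proof.
have [c c0 cP] := qpoch_lower_bound; apply: (lt_le_trans c0).
by apply: limr_ge; [exact: qpoch_cvg | exact: nearW].
Qed.

Lemma qpoch_sub_inf_le n : P n - p <= q ^+ n / (1 - q).
Proof.
rewrite lerBlDr -lerBlDl; apply: limr_ge; first exact: qpoch_cvg.
exists n => // m /= nm; rewrite lerBlDl -lerBlDr; exact: qpoch_sub_le.
Qed.

(* [P_s * binom(s, a)_q * P_a], extended by 0 to [a > s] *)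
Definition qfall (s a : nat) : R :=
  if (a <= s)%N then P s ^+ 2 / P (s - a) else 0.

Definition qweight (a : nat) : R := q ^+ (a.+1 ^ 2) / P a ^+ 2.

Local Notation W := (limn [series qweight a]_a).

Lemma qfall_ge0 s a : 0 <= qfall s a.
Proof.
rewrite /qfall; case: ifP => // _.
by rewrite divr_ge0 ?sqr_ge0 ?ltW ?qpoch_gt0.
Qed.

Lemma qfall_le s a : qfall s a <= P s.
Proof.
rewrite /qfall; case: ifP => _; last by rewrite ltW ?qpoch_gt0.
rewrite ler_pdivrMr ?qpoch_gt0 // expr2 ler_pM2l ?qpoch_gt0 //.
by apply: qpoch_nonincreasing; rewrite leq_subr.
Qed.

(** For [a <= s] the error is at most q^(s-a)/(1-q). Multiplying by q^a also covers [a > s], where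
    [qfall] is 0 and p q^a <= q^s. *)
Lemma qfall_dist_le s a : `|qfall s a - p| * q ^+ a <= q ^+ s / (1 - q).
Proof.
have b0 : 0 < 1 - q by rewrite subr_gt0.
have [as_|sa] := leqP a s; last first.
  rewrite /qfall leqNgt sa /= sub0r normrN (gtr0_norm qpoch_inf_gt0).
  apply: (@le_trans _ _ (q ^+ a)).
    by rewrite ler_piMl ?exprn_ge0 ?qpoch_inf_le1 // ltW.
  rewrite ler_pdivlMr //; apply: (@le_trans _ _ (q ^+ a)).
    by rewrite ler_piMr ?exprn_ge0 ?ltW // gtrBl.
  by rewrite ler_wiXn2l ?(ltW q0) ?(ltW q1) // ltnW.
have -> : q ^+ s / (1 - q) = q ^+ (s - a) / (1 - q) * q ^+ a.
  by rewrite mulrAC -exprD subnK.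
rewrite ler_pM2r ?exprn_gt0 // ler_norml; apply/andP; split; last first.
  apply: (@le_trans _ _ (P s - p)); first by rewrite lerD2r qfall_le.
  apply: (le_trans (qpoch_sub_inf_le s)); rewrite ler_pM2r ?invr_gt0 //.
  by rewrite ler_wiXn2l ?ltW // leq_subr.
have h := qpoch_sub_le (leq_subr a s).
have hp := qpoch_inf_le s.
(* Since [p <= P s], bounding [P s - qfall s a] is enough; it equals (x/y)(y - x) with x = [P s] and
   y = [P (s - a)], and x <= y. *)
suff : P s - qfall s a <= P (s - a) - P s by lra.
have := qpoch_nonincreasing (leq_subr a s).
rewrite /qfall as_; have x0 := qpoch_gt0 s; have y0 := qpoch_gt0 (s - a).
set x := P s in x0 *; set y := P (s - a) in y0 *; move=> xy.
have -> : x - x ^+ 2 / y = (x / y) * (y - x) by field; rewrite lt0r_neq0.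
by rewrite ler_piMl ?subr_ge0 // ler_pdivrMr // mul1r.
Qed.

Lemma qweight_ge0 a : 0 <= qweight a.
Proof. by rewrite divr_ge0 ?exprn_ge0 ?ltW ?qpoch_gt0. Qed.

(* [(a+1)^2 >= 2a], which pays for the factor [q^-a] lost in [qfall_dist_le] *)
Lemma qweight_le a : qweight a <= q ^+ a * (q ^+ a / p ^+ 2).
Proof.
rewrite mulrA -exprD ler_pM ?invr_ge0 ?sqr_ge0 ?exprn_ge0 ?(ltW q0) //.
  by rewrite ler_wiXn2l ?(ltW q0) ?(ltW q1) //; lia.
rewrite lef_pV2 ?posrE ?exprn_gt0 ?qpoch_gt0 ?qpoch_inf_gt0 //.
by rewrite lerXn2r ?nnegrE ?qpoch_inf_le // ltW ?qpoch_gt0 ?qpoch_inf_gt0.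
Qed.

Lemma sum_geometric_le n : \sum_(0 <= k < n) q ^+ k <= (1 - q)^-1.
Proof.
have b0 : 0 < 1 - q by rewrite subr_gt0.
rewrite -(ler_pM2l b0) mulBr_geometric // divff ?lt0r_neq0 // expr0.
by rewrite gerBl exprn_ge0 ?ltW.
Qed.

Lemma qweight_cvg : [series qweight a]_a @ \oo --> W.
Proof.
apply: nondecreasing_is_cvgn.
  by apply: nondecreasing_series => n _ _; exact: qweight_ge0.
exists ((1 - q)^-1 / p ^+ 2) => _ [n _ <-]; rewrite /series /=.
apply: (@le_trans _ _ (\sum_(0 <= k < n) q ^+ k / p ^+ 2)).
  apply: ler_sum => k _; apply: (le_trans (qweight_le k)).
  rewrite ler_piMl ?exprn_ile1 ?divr_ge0 ?exprn_ge0 ?ltW ?qpoch_inf_gt0 //.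
by rewrite -mulr_suml ler_wpM2r ?sum_geometric_le // invr_ge0 sqr_ge0.
Qed.

Lemma qweight_lim_ge0 : 0 <= W.
Proof.
apply: limr_ge; first exact: qweight_cvg.
by apply: nearW => n; apply: sumr_ge0 => a _; exact: qweight_ge0.
Qed.

(** * Approximation of the fixed-point probabilities by their limit *)

Definition qfall_sum s t n : R := \sum_(0 <= a < n) qweight a * qfall s a * qfall t a.

(** Write xy - p^2 = (x - p) y + p (y - p) with y, p <= 1. Of the two factors q^a in [qweight_le],
    one is spent in [qfall_dist_le] and the other makes the sum over [a] geometric, so the bound is
    uniform in [n]. *)
Lemma qfall_sum_dist_le s t n :
  `|qfall_sum s t n - p ^+ 2 * \sum_(0 <= a < n) qweight a| <=
  (q ^+ s + q ^+ t) / (p * (1 - q)) ^+ 2.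
Proof.
have b0 : 0 < 1 - q by rewrite subr_gt0.
have p0 := qpoch_inf_gt0.
rewrite /qfall_sum mulr_sumr -sumrB.
apply: (le_trans (ler_norm_sum _ _ _)).
set D := (q ^+ s + q ^+ t) / (1 - q) / p ^+ 2.
apply: (@le_trans _ _ (\sum_(0 <= a < n) q ^+ a * D)).
  apply: ler_sum => a _.
  have -> : qweight a * qfall s a * qfall t a - p ^+ 2 * qweight a =
    qweight a * ((qfall s a - p) * qfall t a + p * (qfall t a - p)) by ring.
  rewrite normrM (ger0_norm (qweight_ge0 a)).
  apply: (@le_trans _ _ (q ^+ a * (q ^+ a / p ^+ 2) * (`|qfall s a - p| + `|qfall t a - p|))).
    apply: ler_pM; rewrite ?qweight_ge0 ?qweight_le //.
    apply: (le_trans (ler_normD _ _)); rewrite !normrM; apply: lerD.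
      rewrite ler_piMr // ger0_norm ?qfall_ge0 //.
      by rewrite (le_trans (qfall_le _ _)) // qpoch_le1.
    by rewrite ler_piMl // gtr0_norm // qpoch_inf_le1.
  have -> : q ^+ a * (q ^+ a / p ^+ 2) * (`|qfall s a - p| + `|qfall t a - p|) =
    q ^+ a * ((`|qfall s a - p| * q ^+ a + `|qfall t a - p| * q ^+ a) / p ^+ 2) by ring.
  rewrite ler_pM2l ?exprn_gt0 // ler_pM2r ?invr_gt0 ?exprn_gt0 //.
  by rewrite mulrDl lerD ?qfall_dist_le.
rewrite -mulr_suml.
have -> : (q ^+ s + q ^+ t) / (p * (1 - q)) ^+ 2 = (1 - q)^-1 * D.
  by rewrite /D; field; rewrite !lt0r_neq0.
rewrite ler_wpM2r ?sum_geometric_le //.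
by rewrite /D !divr_ge0 ?(ltW b0) ?sqr_ge0 ?addr_ge0 ?exprn_ge0 ?(ltW q0).
Qed.

Lemma qfall_sum_lim_dist_le s t :
  `|qfall_sum s t s.+1 - p ^+ 2 * W| <= (q ^+ s + q ^+ t) / (p * (1 - q)) ^+ 2.
Proof.
have c : `|qfall_sum s t s.+1 - p ^+ 2 * \sum_(0 <= a < n) qweight a| @[n --> \oo]
    --> `|qfall_sum s t s.+1 - p ^+ 2 * W|.
  by apply: cvg_norm; apply: cvgB; [exact: cvg_cst | apply: cvgMr; exact: qweight_cvg].
rewrite -(cvg_lim _ c) //; apply: limr_le; first by apply/cvg_ex; eexists; exact: c.
(* Summands with [a > s] vanish, so the sum is already complete at [s.+1] and only the series of
   weights moves with [n]. *)
exists s.+1 => // n /= sn; suff -> : qfall_sum s t s.+1 = qfall_sum s t n.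
  exact: qfall_sum_dist_le.
rewrite /qfall_sum [RHS](@big_cat_nat _ _ _ s.+1) //= [X in _ + X]big_nat_cond.
rewrite [X in _ + X]big1 ?addr0 // => a /andP[/andP[sa _] _].
by rewrite [qfall s a]/qfall leqNgt sa mulr0 mul0r.
Qed.

(** Reversing the sum replaces [c] by the crossing number a = s - c, the index of the limit series;
    [q^-1] accounts for the exponent (a+1)^2 - 1. *)
Lemma crossing_sumE s t :
  crossing_sum (s + t) s s = q^-1 * qfall_sum s t s.+1.
Proof.
rewrite /crossing_sum addKn big_nat_rev /= /qfall_sum !mulr_sumr.
apply: eq_big_nat => a /andP[_ as_]; rewrite ltnS in as_.
rewrite add0n subSS (subSn (leq_subr a s)) subKn //.
rewrite /qbin /qfall leq_subr subKn // as_ /qweight.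
case: ifP => _; last by rewrite !mulr0.
have -> : q ^+ (a.+1 ^ 2) = q * q ^+ (a.+1 * a.+1).-1.
  by rewrite -exprS; congr (q ^+ _); lia.
by field; rewrite !lt0r_neq0 ?qpoch_gt0.
Qed.

Definition fixed_density : R := (1 - q) / q * p * W.

Lemma crossing_prob_dist_le : exists2 C : R, 0 <= C & forall s t,
  `|(1 - q) * crossing_sum (s + t) s s / P (s + t).+1 - fixed_density| <=
  C * (q ^+ s + q ^+ t).
Proof.
have b0 : 0 < 1 - q by rewrite subr_gt0.
have p0 := qpoch_inf_gt0; have W0 := qweight_lim_ge0.
pose D := (p * (1 - q)) ^- 2.
have D0 : 0 <= D by rewrite invr_ge0 sqr_ge0.
(* [D / p] comes from replacing the numerator by p^2 W, with [P n >= p] below it; [W / (1 - q)]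
   comes from replacing the denominator [P n] by [p]. *)
exists ((1 - q) / q * (D / p + W / (1 - q))).
  rewrite mulr_ge0 ?divr_ge0 ?(ltW b0) ?(ltW q0) //.
  by rewrite addr_ge0 ?divr_ge0 ?(ltW b0) ?(ltW p0).
move=> s t; rewrite crossing_sumE; set n := (s + t).+1.
have Pn := qpoch_gt0 n; have pP := qpoch_inf_le n.
set S := qfall_sum _ _ _; have hS : `|S - p ^+ 2 * W| <= _ := qfall_sum_lim_dist_le s t.
have -> : (1 - q) * (q^-1 * S) / P n - fixed_density =
    (1 - q) / q * ((S - p ^+ 2 * W) / P n - W * (p / P n * (P n - p))).
  by rewrite /fixed_density; field; rewrite !lt0r_neq0.
have k0 : 0 < (1 - q) / q by rewrite divr_gt0.
rewrite normrM (gtr0_norm k0) -[leRHS]mulrA (ler_pM2l k0).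
apply: (le_trans (ler_normB _ _)); rewrite [leRHS]mulrDl lerD //.
  rewrite normrM (@gtr0_norm _ (P n)^-1) ?invr_gt0 //.
  have -> : D / p * (q ^+ s + q ^+ t) =
      (q ^+ s + q ^+ t) / (p * (1 - q)) ^+ 2 / p by rewrite /D; ring.
  by rewrite ler_pM ?normr_ge0 ?invr_ge0 ?(ltW Pn) // lef_pV2 ?posrE.
rewrite normrM (ger0_norm W0) -[leRHS]mulrA ler_wpM2l // [leRHS]mulrC.
rewrite ger0_norm; last by rewrite mulr_ge0 ?divr_ge0 ?subr_ge0 ?(ltW p0) ?(ltW Pn).
apply: (@le_trans _ _ (P n - p)).
  by rewrite ler_piMl ?subr_ge0 // ler_pdivrMr // mul1r.
apply: (le_trans (qpoch_sub_inf_le n)); rewrite ler_pM2r ?invr_gt0 //.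
apply: (@le_trans _ _ (q ^+ s)); last by rewrite lerDl exprn_ge0 ?ltW.
by rewrite ler_wiXn2l ?ltW // /n; lia.
Qed.

Lemma average_crossing_prob_cvg :
  n.+1%:R^-1 * (\sum_(0 <= s < n.+1) (1 - q) * crossing_sum n s s / P n.+1)
    @[n --> \oo] --> fixed_density.
Proof.
have [C C0 hC] := crossing_prob_dist_le.
(* The errors q^s and q^(n-s) each sum to at most 1/(1-q) over [s]; [harmonic n] is the averaging
   factor 1/(n+1). *)
pose e n := C * (2 / (1 - q)) * harmonic n.
have e0 : e n @[n --> \oo] --> 0.
  by rewrite -[X in _ --> X](mulr0 (C * (2 / (1 - q)))); apply: cvgMr; exact: cvg_harmonic.
apply: (@squeeze_cvgr _ _ _ _ (fun n => fixed_density - e n) (fun n => fixed_density + e n)).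
- apply: nearW => n; rewrite -ler_distlC distrC.
  have n0 : (n.+1%:R : R) != 0 by rewrite pnatr_eq0.
  rewrite -[X in _ - X](mulKf n0).
  have -> : n.+1%:R * fixed_density = \sum_(0 <= s < n.+1) fixed_density.
    by rewrite sumr_const_nat subn0 mulr_natl.
  rewrite -mulrBr -sumrB normrM gtr0_norm ?invr_gt0 ?ltr0n //.
  rewrite /e mulrC ler_pM2r ?invr_gt0 ?ltr0n //.
  apply: (le_trans (ler_norm_sum _ _ _)).
  apply: (@le_trans _ _ (\sum_(0 <= s < n.+1) C * (q ^+ s + q ^+ (n - s)))).
    rewrite big_nat_cond [leRHS]big_nat_cond; apply: ler_sum => s /andP[/andP[_ sn] _].
    by have := hC s (n - s)%N; rewrite subnKC.
  rewrite -mulr_sumr ler_wpM2l // big_split /=.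
  rewrite [X in _ + X]big_nat_rev /= add0n.
  rewrite [X in _ + X](eq_big_nat _ _ (F2 := fun k => q ^+ k)); last first.
    by move=> k /andP[_ kn]; rewrite subSS subKn.
  have := sum_geometric_le n.+1; lra.
- by rewrite -[X in _ --> X]subr0; apply: cvgB => //; exact: cvg_cst.
- by rewrite -[X in _ --> X]addr0; apply: cvgD => //; exact: cvg_cst.
Qed.
End qcount.

(** * Expectations under the Mallows distribution and the limit *)

Lemma expectation_fun_perm (d : measure_display) (T : measurableType d)
    (R : realType) (Pr : probability T R) (n : nat) (q : R) (w : T -> 'S_n)
    (g : 'S_n -> R) :
  mallows_distributed Pr q w -> (forall s, 0 <= g s) ->
  'E_Pr[fun x => g (w x)]%E =
  ((\sum_(s : 'S_n) g s * q ^+ inversions s) / mallows_Z n q)%:E.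
Proof.
move=> hw g0; rewrite unlock.
(* Decomposing along the fibres of [w] gives a finite sum of nonnegative multiples of indicators,
   measurable by the fibrewise hypothesis. *)
rewrite (eq_integral (fun x =>
    \sum_(s : 'S_n) (g s)%:E * (\1_(w @^-1` [set s]) x)%:E)%E); last first.
  move=> x _; rewrite (bigD1 (w x)) //= indicE mem_set // mule1.
  rewrite big1 ?adde0 // => s sw; rewrite indicE memNset ?mule0 //.
  by move=> /= e; rewrite e eqxx in sw.
rewrite ge0_integral_sum //; last first.
- by move=> s x _; rewrite mule_ge0 // lee_fin.
- move=> s; apply: measurable_funeM; apply/measurable_EFinP.
  by apply: measurable_indic; exact: (hw s).1.
rewrite mulr_suml -sumEFin; apply: eq_bigr => s _.
have mi : measurable_fun setT (EFin \o (\1_(w @^-1` [set s]) : T -> R)).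
  by apply/measurable_EFinP; apply: measurable_indic; exact: (hw s).1.
rewrite ge0_integralZl_EFin //.
have [ms ws] := hw s.
rewrite integral_indic // setIT -mulrA EFinM; congr (_ * _)%E; exact: ws.
Qed.

Theorem proposition5p3 (R : realType) (q : R) (hq0 : 0 < q) (hq1 : q < 1)
    (d : nat -> measure_display) (T : forall n : nat, measurableType (d n))
    (P : forall n : nat, probability (T n) R)
    (w : forall n : nat, T n -> 'S_n)
    (hw : forall n : nat, (1 <= n)%N -> mallows_distributed (P n) q (w n)) :
  ((n%:R^-1)%:E * 'E_(P n)[fun x => (fixed_points (w n x))%:R])%E
    @[n --> \oo] -->
  ((1 - q) / q * qpoch_inf q q *
     limn [series q ^+ (j.+1 ^ 2) / qpoch q q j ^+ 2]_j)%:E.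
Proof.
(* Shifting the index discards [n = 0], about which [hw] says nothing. *)
rewrite -cvg_shiftS /=.
under eq_fun => n.
  rewrite (expectation_fun_perm (hw n.+1 isT) (fun s => ler0n R (fixed_points s))).
  rewrite (sum_fixed_points hq0 hq1) -EFinM.
  over.
apply: cvg_EFin; first exact: nearW.
exact: (average_crossing_prob_cvg hq0 hq1).
Qed.
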